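(* Let $t\ge2$, $N=t+2$, and let $\lambda$ be a partition with at most $N$ parts. Suppose exactly two residue classes $r_A<r_B$ modulo $t$ (with $0\le r_A<r_B\le t-1$) contain two elements of $\beta(\lambda)$ and every other class contains exactly one. Then $$d_3=0\iff t\text{ is even},\quad r_B-r_A=\tfrac t2,\quad\text{and}\quad |\lambda^{(r_A)}|=|\lambda^{(r_B)}|+1.$$ In particular, for $t$ odd and any partition $\lambda$ with at most $N$ parts, $s_\lambda(1,\zeta,\dots,\zeta^{t-1},z,z^{-1})=0$ (identically in $z$, $\zeta=e^{2\pi i/t}$) if and only if some residue class modulo $t$ contains no element of $\beta(\lambda)$.
   Context: For $\lambda=(\lambda_1\ge\dots\ge\lambda_N\ge0)$ let $\beta_j=\lambda_j+N-j$ and $\beta(\lambda)=\{\beta_1>\dots>\beta_N\}$. $\{a_1>a_2\}$ and $\{b_1>b_2\}$ are the elements of $\beta(\lambda)$ in the classes $r_A$ and $r_B$, and $d_3=|a_1+a_2-b_1-b_2|$. The $t$-quotient $(\lambda^{(0)},\dots,\lambda^{(t-1)})$ is computed from this beta set with $N$ elements: if the elements of $\beta(\lambda)$ congruent to $i$ modulo $t$ are $t\tilde a_1+i>\dots>t\tilde a_{n}+i$, then $\lambda^{(i)}=(\tilde a_1-n+1,\tilde a_2-n+2,\dots,\tilde a_n)$. *)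

(* Defs.v *)
From mathcomp Require Import all_boot all_order all_algebra.
From mathcomp Require Import mpoly.
From mathcomp Require Import reals trigo.
From mathcomp.real_closed Require Import complex.

Set Implicit Arguments.
Unset Strict Implicit.
Unset Printing Implicit Defensive.

Import Order.TTheory GRing.Theory Num.Theory.

(* Parts and beta numbers are indexed from 0 here, so beta_(j+1) is the entry
   of index j, namely lam_j + n - (j + 1).  For lam nonincreasing, beta lam is
   strictly decreasing. *)
Definition beta (n : nat) (lam : n.-tuple nat) : seq nat :=
  mkseq (fun j => nth 0 lam j + (n - j.+1)) n.

Definition beta_class (t n : nat) (lam : n.-tuple nat) (i : nat) : seq nat :=
  [seq b <- beta lam | b %% t == i].

(* The part of index j is a~_(j+1) - m + (j+1), with m the size of the class;
   adding first keeps the truncated subtraction exact, as the a~ are distinct,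
   decreasing naturals. *)
Definition quotient_part (t n : nat) (lam : n.-tuple nat) (i : nat) : seq nat :=
  let a := [seq b %/ t | b <- beta_class t lam i] in
  mkseq (fun j => (nth 0 a j + j.+1) - size a) (size a).

(* Meaningful when the classes rA and rB both have exactly two elements. *)
Definition d3 (t n : nat) (lam : n.-tuple nat) (rA rB : nat) : int :=
  let a := beta_class t lam rA in
  let b := beta_class t lam rB in
  `|(nth 0 a 0)%:Z + (nth 0 a 1)%:Z - (nth 0 b 0)%:Z - (nth 0 b 1)%:Z|%R.

Local Open Scope ring_scope.

Lemma det_exp_Vandermonde (A : comNzRingType) (n : nat) (x : 'I_n -> A)
    (e : nat -> nat) :
  exists s : A,
    s * \det (\matrix_(i < n, j < n) x i ^+ (n - j.+1))
      = \det (\matrix_(i < n, j < n) x i ^+ e j).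
Proof.
pose P : {poly A} := \prod_(i < n) ('X - (x i)%:P).
have Pmonic : P \is monic by apply: monic_prod_XsubC.
have szP : size P = n.+1.
  by rewrite size_prod_XsubC /index_enum -enumT size_enum_ord.
pose r (b : nat) := Pdiv.Ring.rmodp 'X^b P.
have szr b : (size (r b) <= n)%N.
  by rewrite -ltnS -szP; apply/Pdiv.Ring.ltn_rmodpN0/monic_neq0.
have xE i b : x i ^+ b = (r b).[x i].
  have P0 : P.[x i] = 0.
    by rewrite /P horner_prod (bigD1 i) //= hornerXsubC subrr mul0r.
  have /(congr1 (horner^~ (x i))) := Pdiv.RingMonic.rdivp_eq Pmonic 'X^b.
  by rewrite /= hornerXn hornerD hornerM P0 mulr0 add0r.
pose C := \matrix_(k < n, j < n) (r (e j))`_(n - k.+1).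
exists (\det C); rewrite mulrC -det_mulmx; congr (\det _).
apply/matrixP => i j; rewrite !mxE xE (horner_coef_wide _ (szr _)).
rewrite (reindex_inj rev_ord_inj) /=; apply: eq_bigr => k _.
rewrite !mxE mulrC.
by have -> : (n - (rev_ord k).+1)%N = k := congr1 val (rev_ordK k).
Qed.

Section Schur.
Variables (R : comNzRingType) (n : nat).

Definition alternant (lam : n.-tuple nat) : {mpoly R[n]} :=
  \det (\matrix_(i < n, j < n) ('X_i : {mpoly R[n]}) ^+ nth 0%N (beta lam) j).

Definition empty_partition : n.-tuple nat := [tuple of nseq n 0%N].

Lemma alternant_dvd (lam : n.-tuple nat) :
  exists s : {mpoly R[n]}, s * alternant empty_partition == alternant lam.
Proof.
have [s sE] := det_exp_Vandermonde (fun i => 'X_i : {mpoly R[n]})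
                 (nth 0%N (beta lam)).
exists s; apply/eqP; rewrite -[RHS]sE; congr (_ * \det _).
by apply/matrixP => i j; rewrite !mxE nth_mkseq // nth_nseq if_same add0n.
Qed.

(* The quotient a_(lam + delta) / a_delta of alternants; it is unique since
   the Vandermonde polynomial a_delta is not a zero divisor. *)
Definition schur (lam : n.-tuple nat) : {mpoly R[n]} :=
  xchoose (alternant_dvd lam).

Lemma schurE (lam : n.-tuple nat) :
  schur lam * alternant empty_partition = alternant lam.
Proof. exact/eqP/(xchooseP (alternant_dvd lam)). Qed.

End Schur.

Definition zeta (R : realType) (t : nat) : R[i] :=
  (cos (2 * pi / t%:R) +i* sin (2 * pi / t%:R))%C.

(* The point (1, zeta, ..., zeta^(t-1), z, z^-1). *)
Definition twisted_point (R : realType) (t : nat) (z : R[i]) (i : 'I_(t + 2)) :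
    R[i] :=
  if (i < t)%N then zeta R t ^+ i else if i == t :> nat then z else z^-1.

(* Main.v *)
(* At a generic z the evaluation points are distinct, so s_lambda is the quotient
   of det (x_i ^ beta_j) by a nonzero Vandermonde determinant.  A kernel vector
   of that matrix sums to 0 over each class mod t, by the discrete Fourier
   transform on the rows of the roots of unity.  If a class is empty these t rows
   are dependent.  Otherwise pick one beta number in each class: the
   two remaining ones p, q, with representatives p', q' of their classes, leave a
   2x2 system in the rows of z and z^-1, which is singular only when
   p + p' = q + q'; for t odd this forces p = q mod t, then p' = q' and p = q.
   The exceptional values of z are reached by clearing the denominators of the
   Laurent polynomial z |-> s_lambda(1, ..., zeta^(t-1), z, z^-1). *)
Require Import Defs.
From mathcomp Require Import all_boot all_order all_algebra.
From mathcomp Require Import zify ring.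
From mathcomp Require Import mpoly.
From mathcomp Require Import reals trigo.
From mathcomp.real_closed Require Import complex.

Set Implicit Arguments.
Unset Strict Implicit.
Unset Printing Implicit Defensive.

Import Order.TTheory GRing.Theory Num.Theory.

(** * Beta numbers, residue classes and the criterion for [d3] *)

Lemma nth_beta n (lam : n.-tuple nat) j : j < n ->
  nth 0 (beta lam) j = nth 0 lam j + (n - j.+1).
Proof. by move=> jn; rewrite nth_mkseq. Qed.

Lemma beta_ltn n (lam : n.-tuple nat) i j : sorted geq lam -> i < j < n ->
  nth 0 (beta lam) j < nth 0 (beta lam) i.
Proof.
move=> lam_sorted /andP[ij jn]; rewrite !nth_beta ?(ltn_trans ij) //.
have := sorted_leq_nth (fun b a c ba cb => leq_trans cb ba) leqnn 0 lam_sorted.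
move=> /(_ i j); rewrite !inE size_tuple => /(_ (ltn_trans ij jn) jn (ltnW ij)).
rewrite /geq /=; lia.
Qed.

Lemma beta_sorted n (lam : n.-tuple nat) :
  sorted geq lam -> sorted gtn (beta lam).
Proof.
move=> lam_sorted; apply/(sortedP 0) => i; rewrite size_mkseq => iS.
by apply: beta_ltn; rewrite // ltnSn.
Qed.

Lemma beta_inj n (lam : n.-tuple nat) : sorted geq lam ->
  injective (fun j : 'I_n => nth 0 (beta lam) j).
Proof.
move=> lam_sorted i j eq_ij; apply/val_inj => /=.
by case: (ltngtP i j) => // ij;
  have := beta_ltn lam_sorted (introT andP (conj ij (ltn_ord _)));
  rewrite eq_ij ltnn.
Qed.

Lemma beta_class_pair t n (lam : n.-tuple nat) r :
    sorted geq lam -> size (beta_class t lam r) = 2 ->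
  exists x y, y < x /\ beta_class t lam r = [:: x * t + r; y * t + r].
Proof.
move=> /beta_sorted beta_sorted sz2.
have : sorted gtn (beta_class t lam r).
  by apply: sorted_filter beta_sorted => b a c ba cb; apply: ltn_trans cb ba.
have : all (fun b => b %% t == r) (beta_class t lam r) by apply: filter_all.
case: beta_class sz2 => [|a [|b []]] //= _ /and3P[/eqP ar /eqP br _] /andP[ba _].
have aE : a = a %/ t * t + r by rewrite {1}(divn_eq a t) ar.
have bE : b = b %/ t * t + r by rewrite {1}(divn_eq b t) br.
exists (a %/ t), (b %/ t); rewrite -aE -bE; split=> //.
by move: ba; rewrite /gtn /= {1}aE {1}bE ltn_add2r ltn_mul2r => /andP[].
Qed.

(** The two parts are x - 1 and y; y < x makes x positive, so the truncated predecessor is exact. *)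
Lemma sumn_quotient_pair t n (lam : n.-tuple nat) r x y :
    r < t -> y < x -> beta_class t lam r = [:: x * t + r; y * t + r] ->
  sumn (quotient_part t lam r) = (x + y).-1.
Proof.
move=> rt yx; rewrite /quotient_part => -> /=.
have t0 : 0 < t by apply: leq_ltn_trans rt.
rewrite !divnMDl // divn_small //; lia.
Qed.

(** With classes xt + rA, yt + rA and zt + rB, wt + rB, [d3] vanishes iff (x + y - z - w)t = 2(rB -
    rA). The right side lies strictly between 0 and 2t, so the integer factor is 1; that factor is
    also the difference of the two quotient sizes. *)
Lemma d3_eq0 t (lam : (t + 2).-tuple nat) rA rB : 
    sorted geq lam -> rA < rB -> rB < t ->
    size (beta_class t lam rA) = 2 -> size (beta_class t lam rB) = 2 ->
  d3 t lam rA rB = 0%R <->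
    [/\ ~~ odd t, rB - rA = t./2 &
      sumn (quotient_part t lam rA) = sumn (quotient_part t lam rB) + 1].
Proof.
move=> lam_sorted rAB rBt.
move=> /(beta_class_pair lam_sorted)[x [y [yx eqA]]].
move=> /(beta_class_pair lam_sorted)[z [w [wz eqB]]].
rewrite (sumn_quotient_pair (ltn_trans rAB rBt) yx eqA).
rewrite (sumn_quotient_pair rBt wz eqB) /d3 eqA eqB /=.
have eq_sum : ((x + y).-1 = (z + w).-1 + 1) <-> (x + y = z + w + 1) by lia.
have eq_d3 : `|(x * t + rA)%:Z + (y * t + rA)%:Z
                 - (z * t + rB)%:Z - (w * t + rB)%:Z|%R = 0%R <->
    (x + y) * t + 2 * rA = (z + w) * t + 2 * rB.
  by split=> [/eqP|eq_d]; [rewrite normr_eq0 => /eqP|]; lia.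
rewrite eq_d3; split=> [eq_d|[t_even rAB2 /eq_sum eq1]].
  have eq1 : x + y = z + w + 1.
    have [le|lt] := leqP (x + y) (z + w); first by nia.
    have [->//|lt2] : x + y = z + w + 1 \/ z + w + 2 <= x + y by lia.
    by nia.
  have eqt : t = 2 * (rB - rA) by move: eq_d; rewrite eq1 !mulnDl; lia.
  by split; [lia|lia|apply/eq_sum].
by rewrite eq1 !mulnDl; lia.
Qed.
Lemma beta_class_nilP t n (lam : n.-tuple nat) r :
  beta_class t lam r = [::] <->
  (forall j : 'I_n, nth 0 (beta lam) j %% t != r).
Proof.
split=> [nil j|no_r]; last first.
  apply/eqP; rewrite -[_ == _]negbK -has_filter; apply/hasPn => b /(nthP 0)[j].
  by rewrite size_mkseq => jn <-; apply: (no_r (Ordinal jn)).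
apply/negP => jr; suff : nth 0 (beta lam) j \in beta_class t lam r by rewrite nil.
by rewrite mem_filter jr mem_nth ?size_mkseq.
Qed.

Local Open Scope ring_scope.

(** * Roots of unity and the discrete Fourier transform *)

Lemma zetaX (R : realType) t k :
  zeta R t ^+ k = (cos (2 * pi / t%:R *+ k) +i* sin (2 * pi / t%:R *+ k))%C.
Proof.
rewrite /zeta; set a := _ / _.
elim: k => [|k IHk]; first by rewrite expr0 mulr0n cos0 sin0.
rewrite exprSr IHk mulrSr cosD sinD.
by congr (_ +i* _)%C; rewrite [RHS]addrC.
Qed.

(** For 0 < k < t, half the angle of the k-th power lies in (0, pi), where the sine is positive; cos
    2a = 1 would force sin a = 0. *)
Lemma zeta_prim (R : realType) t : (0 < t)%N -> t.-primitive_root (zeta R t).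
Proof.
move=> t0; rewrite /primitive_root_of_unity t0; apply/forallP => i.
rewrite unity_rootE zetaX; apply/eqP; have [->|i_neq] := eqVneq i.+1 t.
  by rewrite -mulr_natr divfK ?pnatr_eq0 -?lt0n // mulr_natl cos2pi sin2pi eqxx.
have half : 2 * pi / t%:R *+ i.+1 = (pi * (i.+1%:R / t%:R)) *+ 2 :> R.
  by rewrite -[LHS]mulr_natr -[RHS]mulr_natl -!mulrA [t%:R^-1 * _]mulrC.
rewrite half; apply/negP; rewrite eq_complex /= => /andP[/eqP cos1 _].
have : 0 < sin (pi * (i.+1%:R / t%:R) : R).
  have i_lt : (i.+1 < t)%N by rewrite ltn_neqAle i_neq ltn_ord.
  apply: sin_gt0_pi; rewrite pmulr_rgt0 ?pi_gt0 // divr_gt0 ?ltr0n //=.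
  by rewrite gtr_pMr ?pi_gt0 // ltr_pdivrMr ?ltr0n // mul1r ltr_nat.
rewrite lt0r => /andP[/negP[]]; rewrite -sqrf_eq0 sin2cos2.
move: cos1; rewrite cos_mulr2n => /(canRL (subrK _)).
by rewrite -mulr2n => /eqP; rewrite eqr_pMn2r // => /eqP ->; rewrite subrr.
Qed.

Lemma sum_prim_rootX (F : idomainType) t (w : F) m :
  t.-primitive_root w ->
  \sum_(i < t) w ^+ (i * m) = if (t %| m)%N then t%:R else 0.
Proof.
move=> w_prim; under eq_bigr => i _ do rewrite mulnC exprM.
have [t_m|t_m] := ifPn.
  have /eqP -> : w ^+ m == 1 by rewrite -(prim_order_dvd w_prim).
  by under eq_bigr => i _ do rewrite expr1n; rewrite sumr_const card_ord.
apply/eqP; have := subrX1 (w ^+ m) t.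
rewrite exprAC (prim_expr_order w_prim) expr1n subrr => /esym/eqP.
by rewrite mulf_eq0 subr_eq0 -(prim_order_dvd w_prim) (negPf t_m).
Qed.

(** Fourier inversion: the weight is w^(-ir), written with a natural exponent. *)
Lemma sum_prim_root_class (F : idomainType) t (w : F) r b :
    t.-primitive_root w -> (r < t)%N ->
  \sum_(i < t) w ^+ (i * (t - r)) * (w ^+ i) ^+ b =
    if (b %% t == r)%N then t%:R else 0.
Proof.
move=> w_prim rt.
under eq_bigr => i _ do rewrite -exprM -exprD -mulnDr.
rewrite (sum_prim_rootX _ w_prim); congr (if _ then _ else _).
have -> : (t - r + b = t - r + b %% t + b %/ t * t)%N.
  by rewrite {1}(divn_eq b t) addnAC addnA.
rewrite dvdn_addl ?dvdn_mull //.
(* Hence t - r + b mod t lies strictly between 0 and 2t, and t is its only possible multiple of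
   t. *)
have b_lt : (b %% t < t)%N by rewrite ltn_pmod //; lia.
apply/idP/eqP => [/dvdnP[[|[|k]]]|->]; last by rewrite subnK ?dvdnn // ltnW.
- lia.
- lia.
- by rewrite !mulSn; lia.
Qed.

(** * Kernel vectors and the reduced 2x2 system *)

Lemma odd_double_modI t a b : odd t -> a.*2 = b.*2 %[mod t] -> a = b %[mod t].
Proof.
move=> t_odd; wlog ab : a b / (a <= b)%N.
  by move=> th; have [/th//|/ltnW/th ba /esym/ba ->] := leqP a b.
move=> /esym/eqP; rewrite eqn_mod_dvd ?leq_double // -doubleB -mul2n.
by rewrite Gauss_dvdr ?coprimen2 // -eqn_mod_dvd // => /eqP ->.
Qed.

(** This is the nonsingularity of the alternant matrix, with the rows of the roots of unity already
    replaced by class sums. Since 1 < x, powers of x determine their exponents. *)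
Lemma transversal_kernel_eq0 (F : numFieldType) t (e : 'I_(t + 2) -> nat)
    (u : 'I_(t + 2) -> F) (x : F) :
    odd t -> injective e ->
    (forall r, (r < t)%N -> exists j, (e j %% t)%N = r) -> 1 < x ->
    (forall r, (r < t)%N -> \sum_(j | (e j %% t)%N == r) u j = 0) ->
    \sum_j u j * x ^+ e j = 0 -> \sum_j u j * x^-1 ^+ e j = 0 ->
  forall j, u j = 0.
Proof.
move=> t_odd e_inj e_surj x1 class_sum sum_x sum_xV.
have t0 : (0 < t)%N by case: (t) t_odd.
(* [c] sends an index to its class and [f] picks a representative of each class; of the t + 2
   indices exactly two are not representatives. *)
pose c j : 'I_t := Ordinal (ltn_pmod (e j) t0).
have [r|f fK] := fin_all_exists (P := fun r j => c j = r).
  by have [j ej] := e_surj r (ltn_ord r); exists j; apply/val_inj.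
have f_inj : injective f := can_inj fK.
pose A := [set f r | r in 'I_t].
have /cards2P[j1 [j2 [j12 AC]]] : #|~: A| == 2%N.
  by rewrite -(eqn_add2l #|A|) cardsC card_ord card_imset // card_ord.
have jA j : (j \in ~: A) -> f (c j) != j.
  by apply: contraTneq => <-; rewrite inE negbK imset_f.
(* As class sums of [u] vanish, [w] may be lowered by its value at the class representative, which
   kills every term on [A]. *)
have reduce (w : 'I_(t + 2) -> F) :
    \sum_j u j * w j =
      u j1 * (w j1 - w (f (c j1))) + u j2 * (w j2 - w (f (c j2))).
  have sum0 : \sum_j u j * w (f (c j)) = 0.
    rewrite (partition_big c xpredT) //= big1 // => r _.
    rewrite (eq_bigr (fun j => u j * w (f r))) => [|j /eqP <-//].
    by rewrite -mulr_suml [X in X * _](class_sum r (ltn_ord r)) mul0r.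
  rewrite -[LHS]subr0 -[X in _ - X]sum0 -sumrB.
  under eq_bigr => j _ do rewrite -mulrBr.
  rewrite (bigID (mem A)) /= big1 ?add0r => [|_ /imsetP[r _ ->]]; last first.
    by rewrite fK subrr mulr0.
  rewrite (eq_bigl (mem (~: A))) => [|j]; last by rewrite !inE.
  by rewrite AC big_setU1 ?inE //= big_set1.
have [j1A j2A] : f (c j1) != j1 /\ f (c j2) != j2.
  by split; apply: jA; rewrite AC !inE eqxx ?orbT.
have x_inj : injective (GRing.exp x).
  by apply: ieexprIn; rewrite ?gt_eqF // (lt_trans ltr01).
have x0 : x != 0 by rewrite gt_eqF // (lt_trans ltr01).
have xe_neq i j : i != j -> x ^+ e i - x ^+ e j != 0.
  by move=> ij; rewrite subr_eq0 (inj_eq x_inj) (inj_eq e_inj).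
move: sum_x sum_xV; rewrite !reduce !exprVn.
(* Clearing denominators, the system has determinant
   (P - P') (Q - Q') (PP' - QQ'), with P = x ^ e j1, Q = x ^ e j2. *)
set P := x ^+ e j1; set P' := x ^+ e (f (c j1)).
set Q := x ^+ e j2; set Q' := x ^+ e (f (c j2)) => eq1 eq2.
have PQ : P * P' - Q * Q' != 0.
  rewrite subr_eq0 -!exprD (inj_eq x_inj); apply/negP => /eqP e_sum.
  have ec j : (e (f (c j)) = e j %[mod t])%N by have /(congr1 val) := fK (c j).
  have eq_mod : (e j1 = e j2 %[mod t])%N.
    (* A representative is congruent to its index, so the two equal sums are 2 e(j1) and 2 e(j2)
       modulo t. *)
    apply: (odd_double_modI t_odd).
    by rewrite -!addnn -(modnDmr (e j1)) -ec modnDmr e_sum -modnDmr ec modnDmr.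
  have ceq : c j1 = c j2 by apply/val_inj.
  by move/eqP: e_sum; rewrite ceq eqn_add2r (inj_eq e_inj) (negPf j12).
have u2 : u j2 = 0.
  apply/eqP; have : u j2 * ((Q - Q') * (P * P' - Q * Q')) == 0.
    (* The second equation times -PP'QQ' reads QQ'(P - P')u1 + PP'(Q - Q')u2; subtracting QQ' times
       the first eliminates u1. *)
    have -> : u j2 * ((Q - Q') * (P * P' - Q * Q')) =
      - (P * P' * Q * Q') * (u j1 * (P^-1 - P'^-1) + u j2 * (Q^-1 - Q'^-1))
      - Q * Q' * (u j1 * (P - P') + u j2 * (Q - Q')).
      by field; rewrite !expf_neq0.
    by rewrite eq1 eq2 !mulr0 subr0.
  by rewrite !mulf_eq0 (negPf PQ) (negPf (xe_neq _ _ _)) ?orbF // eq_sym.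
have u1 : u j1 = 0.
  apply/eqP; move/eqP: eq1; rewrite u2 mul0r addr0 mulf_eq0.
  by rewrite (negPf (xe_neq _ _ _)) ?orbF // eq_sym.
(* Taking the indicator of [j] for [w] recovers the remaining coordinates. *)
move=> j; have := reduce (fun i => (i == j)%:R); rewrite u1 u2 !mul0r addr0.
rewrite (bigD1 j) //= eqxx mulr1 big1 ?addr0 // => i /negPf ->.
by rewrite mulr0.
Qed.

(** * Vandermonde determinants and the twisted point *)

Lemma det_expX_rev_neq0 (F : idomainType) n (x : 'I_n -> F) :
  injective x -> \det (\matrix_(i < n, j < n) x i ^+ (n - j.+1)) != 0.
Proof.
move=> x_inj; rewrite -det_tr.
(* Decreasing exponents are the usual Vandermonde matrix up to a reversal, which costs only a
   sign. *)
have -> : (\matrix_(i < n, j < n) x i ^+ (n - j.+1))^T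
    = row_perm (perm.perm (@rev_ord_inj n)) (Vandermonde n (\row_j x j)).
  by apply/matrixP => i j; rewrite !mxE perm.permE.
rewrite row_permE det_mulmx det_perm det_Vandermonde mulf_neq0 ?signr_eq0 //.
apply/prodf_neq0 => i _; apply/prodf_neq0 => j ij; rewrite !mxE subr_eq0.
by apply: contraTneq ij => /x_inj ->; rewrite ltnn.
Qed.

(** The bialternant formula at a point, kept as a product because the Vandermonde factor may vanish
    there. *)
Lemma meval_schur (R : comNzRingType) n (lam : n.-tuple nat) (x : 'I_n -> R) :
  (schur R lam).@[x] * \det (\matrix_(i < n, j < n) x i ^+ (n - j.+1))
    = \det (\matrix_(i < n, j < n) x i ^+ nth 0%N (beta lam) j).
Proof.
have meval_alternant (mu : n.-tuple nat) : (alternant R mu).@[x] =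
    \det (\matrix_(i < n, j < n) x i ^+ nth 0%N (beta mu) j).
  rewrite /alternant -det_map_mx; congr (\det _).
  by apply/matrixP => i j; rewrite !mxE rmorphXn /= mevalXU.
rewrite -[RHS]meval_alternant -schurE mevalM meval_alternant; congr (_ * \det _).
by apply/matrixP => i j; rewrite !mxE nth_beta // nth_nseq if_same.
Qed.

Lemma twisted_point_lshift (R : realType) t (z : R[i]) (i : 'I_t) :
  twisted_point z (lshift 2 i) = zeta R t ^+ i.
Proof. by rewrite /twisted_point /= ltn_ord. Qed.

Lemma twisted_point_z (R : realType) t (z : R[i]) :
  twisted_point z (rshift t (0 : 'I_2)) = z.
Proof. by rewrite /twisted_point /= addn0 ltnn eqxx. Qed.

Lemma twisted_point_zV (R : realType) t (z : R[i]) :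
  twisted_point z (rshift t (1 : 'I_2)) = z^-1.
Proof. by rewrite /twisted_point /= addn1 ltnNge leqnSn /= gtn_eqF. Qed.

(** In [R[i]], 1 < z makes z real. Then z and its inverse lie on opposite sides of 1, and their t-th
    powers are not 1, unlike those of the roots of unity. *)
Lemma twisted_point_inj (R : realType) t (z : R[i]) :
  (0 < t)%N -> 1 < z -> injective (@twisted_point R t z).
Proof.
move=> t0 z1; have z0 : 0 < z := lt_trans ltr01 z1.
have zV1 : z^-1 < 1 by rewrite invf_lt1.
have zeta_neq (y : R[i]) (i : 'I_t) : y ^+ t != 1 -> zeta R t ^+ i != y.
  apply: contraNneq => <-.
  by rewrite exprAC (prim_expr_order (zeta_prim R t0)) expr1n.
have zt : z ^+ t != 1 by rewrite gt_eqF // exprn_egt1 // -lt0n.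
have zVt : z^-1 ^+ t != 1 by rewrite exprVn invr_eq1.
have zeta_z (i : 'I_t) : zeta R t ^+ i == z = false := negbTE (zeta_neq z i zt).
have zeta_zV (i : 'I_t) : zeta R t ^+ i == z^-1 = false := negbTE (zeta_neq _ i zVt).
have z_zV : z == z^-1 = false by rewrite gt_eqF // (lt_trans zV1).
have ord2 (i : 'I_2) : i = 0 \/ i = 1.
  by case: i => [[|[|]]] // p; [left|right]; apply/val_inj.
move=> i j /eqP; rewrite -(splitK i) -(splitK j).
case: (split i) (split j) => [i'|i'] [j'|j'] /=; rewrite ?twisted_point_lshift.
- rewrite (eq_prim_root_expr (zeta_prim R t0)) !modn_small //.
  by move=> /eqP/val_inj ->.
- by case: (ord2 j') => ->;
    rewrite ?twisted_point_z ?twisted_point_zV ?zeta_z ?zeta_zV.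
- by case: (ord2 i') => ->;
    rewrite ?twisted_point_z ?twisted_point_zV eq_sym ?zeta_z ?zeta_zV.
- by case: (ord2 i') (ord2 j') => -> [] ->;
    rewrite ?twisted_point_z ?twisted_point_zV // ?[_^-1 == _]eq_sym z_zV.
Qed.

Lemma det_twisted_point_eq0 (R : realType) t (e : 'I_(t + 2) -> nat) r
    (z : R[i]) :
    (r < t)%N -> (forall j, (e j %% t)%N != r) ->
  \det (\matrix_(i < t + 2, j < t + 2) twisted_point z i ^+ e j) = 0.
Proof.
move=> rt no_r; have t0 : (0 < t)%N by apply: leq_ltn_trans rt.
(* The Fourier weights of class [r], extended by 0 to the rows of z and its inverse; the first entry
   is 1. *)
pose v : 'rV[R[i]]_(t + 2) :=
  \row_i if (i < t)%N then zeta R t ^+ (i * (t - r)) else 0.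
apply/eqP/det0P; exists v.
  apply/eqP => /rowP/(_ (lshift 2 (Ordinal t0))); rewrite !mxE /= t0 mul0n.
  by apply/eqP/oner_neq0.
apply/rowP => j; rewrite !mxE big_split_ord /= [X in _ + X]big1 ?addr0 => [|i _].
  rewrite -[RHS](_ : (if (e j %% t == r)%N then t%:R else 0) = 0).
    rewrite -(sum_prim_root_class _ (zeta_prim R t0) rt); apply: eq_bigr => i _.
    by rewrite !mxE twisted_point_lshift /= ltn_ord.
  by rewrite (negPf (no_r j)).
by rewrite !mxE /= ltnNge leq_addr mul0r.
Qed.

(** * Laurent polynomials in z *)

Lemma meval_twisted_point_poly (R : realType) t (p : {mpoly R[i][t + 2]}) :
  exists (d : nat) (q : {poly R[i]}),
    forall z, z != 0 -> z ^+ d * p.@[twisted_point z] = q.[z].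
Proof.
(* This class of functions contains constants, z and its inverse, and is closed under sums and
   products. *)
pose laurent (f : R[i] -> R[i]) := exists (d : nat) (q : {poly R[i]}),
  forall z, z != 0 -> z ^+ d * f z = q.[z].
have laurent_poly q : laurent (horner q).
  by exists 0%N, q => z _; rewrite mul1r.
have laurentD f g : laurent f -> laurent g -> laurent (fun z => f z + g z).
  move=> [d [q fq]] [d' [q' gq]]; exists (d + d')%N, ('X^d' * q + 'X^d * q') => z z0.
  by rewrite !hornerE -fq // -gq // exprD; ring.
have laurentM f g : laurent f -> laurent g -> laurent (fun z => f z * g z).
  move=> [d [q fq]] [d' [q' gq]]; exists (d + d')%N, (q * q') => z z0.
  by rewrite hornerM -fq // -gq // exprD; ring.
have laurent_ext f g : f =1 g -> laurent f -> laurent g.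
  by move=> fg [d [q fq]]; exists d, q => z z0; rewrite -fg fq.
have laurentC c : laurent (fun=> c).
  by apply: laurent_ext (laurent_poly c%:P) => z; rewrite hornerC.
have laurent_coord (i : 'I_(t + 2)) : laurent (fun z => twisted_point z i).
  rewrite /twisted_point; case: ltnP => _ //; case: eqP => _.
    by apply: laurent_ext (laurent_poly 'X) => z; rewrite hornerX.
  by exists 1%N, 1 => z z0; rewrite hornerC expr1 divff.
have laurentX f n : laurent f -> laurent (fun z => f z ^+ n).
  move=> fL; elim: n => [|n IHn]; first exact: laurentC.
  by apply: laurent_ext (laurentM _ _ fL IHn) => z; rewrite exprS.
apply: (laurent_ext _ _ (fun z => esym (mevalE (twisted_point z) p))).
elim: (msupp p : seq _) => [|m s IHs].
  by apply: laurent_ext (laurentC 0) => z; rewrite big_nil.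
have laurent_prod : laurent (fun z => \prod_i twisted_point z i ^+ m i).
  elim: (index_enum _) => [|i r IHr].
    by apply: laurent_ext (laurentC 1) => z; rewrite big_nil.
  apply: laurent_ext (laurentM _ _ (laurentX _ (m i) (laurent_coord i)) IHr) => z.
  by rewrite big_cons.
apply: laurent_ext (laurentD _ _ (laurentM _ _ (laurentC p@_m) laurent_prod) IHs).
by move=> z; rewrite big_cons.
Qed.

(** The roots start at 2 to stay in the range z > 1, where the twisted point has distinct
    coordinates. *)
Lemma poly_nat_roots_eq0 (F : numDomainType) (q : {poly F}) :
  (forall k, q.[k.+2%:R] = 0) -> q = 0.
Proof.
move=> q_root; apply/eqP/contraT => q0.
have := max_poly_roots q0 (rs := [seq k.+2%:R | k <- iota 0 (size q)]).
rewrite size_map size_iota ltnn => -> //.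
  by apply/allP => _ /mapP[k _ ->]; apply/rootP.
by rewrite map_inj_uniq ?iota_uniq // => j k /eqP; rewrite eqr_nat => /eqP[].
Qed.

(** * Vanishing of the twisted Schur polynomial *)

Lemma meval_twisted_schur_eq0 (R : realType) t (lam : (t + 2).-tuple nat) r
    (z : R[i]) :
    (r < t)%N -> beta_class t lam r = [::] -> z != 0 ->
  (schur R[i] lam).@[twisted_point z] = 0.
Proof.
move=> rt /beta_class_nilP no_r z0; have t0 : (0 < t)%N by apply: leq_ltn_trans rt.
have [d [q sq]] := meval_twisted_point_poly (schur R[i] lam).
apply/(mulfI (expf_neq0 d z0)); rewrite mulr0 sq // (_ : q = 0) ?horner0 //.
(* At z = k + 2 the alternant vanishes while the Vandermonde factor does not. *)
apply: poly_nat_roots_eq0 => k; rewrite -sq ?pnatr_eq0 //.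
have k1 : 1 < k.+2%:R :> R[i] by rewrite ltr1n.
have /eqP := meval_schur lam (@twisted_point R t k.+2%:R).
rewrite (det_twisted_point_eq0 _ rt no_r) mulf_eq0.
by rewrite (negPf (det_expX_rev_neq0 (twisted_point_inj t0 k1))) orbF => /eqP ->;
  rewrite mulr0.
Qed.

Lemma meval_twisted_schur_neq0 (R : realType) t (lam : (t + 2).-tuple nat)
    (z : R[i]) :
    odd t -> sorted geq lam ->
    (forall r, (r < t)%N -> beta_class t lam r <> [::]) ->
  1 < z -> (schur R[i] lam).@[twisted_point z] != 0.
Proof.
move=> t_odd lam_sorted nonempty z1; have t0 : (0 < t)%N by case: (t) t_odd.
apply/negP => /eqP s0; pose e (j : 'I_(t + 2)) := nth 0%N (beta lam) j.
have := meval_schur lam (@twisted_point R t z); rewrite s0 mul0r => /esym/eqP.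
(* Transposing turns the left kernel vector of [det0P] into a relation among columns, indexed by
   beta numbers. *)
rewrite -det_tr => /det0P[u u0 /rowP uM].
have row_i i : \sum_j u 0 j * @twisted_point R t z i ^+ e j = 0.
  by have := uM i; rewrite !mxE => uMi; rewrite -[RHS]uMi;
    apply: eq_bigr => j _; rewrite !mxE.
case/negP: u0; apply/eqP/rowP => j; rewrite mxE.
apply: (@transversal_kernel_eq0 _ t e (u 0) z) => //.
- exact: beta_inj.
- move=> r /nonempty r_nonempty.
  suff /existsP[j' /eqP] : [exists j', e j' %% t == r]%N by exists j'.
  apply: contra_notT r_nonempty.
  by rewrite negb_exists => /forallP no_r; apply/beta_class_nilP.
(* t times the class sum is the Fourier combination of the rows of the roots of unity, each of which
   annihilates [u]. *)
- move=> r rt; have t_neq0 : t%:R != 0 :> R[i]%C by rewrite pnatr_eq0 -lt0n.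
  apply: (mulfI t_neq0); rewrite mulr0 big_mkcond mulr_sumr /=.
  transitivity (\sum_j u 0 j *
      \sum_(i < t) zeta R t ^+ (i * (t - r)) * (zeta R t ^+ i) ^+ e j).
    apply: eq_bigr => k _; rewrite (sum_prim_root_class _ (zeta_prim R t0) rt).
    by case: ifP => _; rewrite ?mulr0 // mulrC.
  under eq_bigr => k _ do rewrite mulr_sumr.
  rewrite exchange_big big1 //= => i _; have := row_i (lshift 2 i).
  rewrite twisted_point_lshift => /(congr1 (GRing.mul (zeta R t ^+ (i * (t - r))))).
  by rewrite mulr0 mulr_sumr => zeta_row; rewrite -[RHS]zeta_row;
    apply: eq_bigr => k _; rewrite mulrCA.
- by have := row_i (rshift t 0); rewrite twisted_point_z.
- by have := row_i (rshift t 1); rewrite twisted_point_zV.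
Qed.

Local Close Scope ring_scope.

Theorem proposition3p5 (R : realType) (t : nat) (ht : (2 <= t)%N) :
  (forall (lam : (t + 2).-tuple nat) (rA rB : nat),
      sorted geq lam ->
      (rA < rB)%N -> (rB <= t - 1)%N ->
      size (beta_class t lam rA) = 2%N ->
      size (beta_class t lam rB) = 2%N ->
      (forall i : nat, (i < t)%N -> i <> rA -> i <> rB ->
         size (beta_class t lam i) = 1%N) ->
      (d3 t lam rA rB = 0%R <->
       [/\ ~~ odd t,
           (rB - rA)%N = t./2 &
           sumn (quotient_part t lam rA)
             = (sumn (quotient_part t lam rB) + 1)%N]))
  /\
  (odd t ->
   forall lam : (t + 2).-tuple nat,
     sorted geq lam ->
     ((forall z : R[i], z != 0%R ->
         (schur R[i] lam).@[twisted_point z] = 0%R)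
      <-> exists2 i : nat, (i < t)%N & beta_class t lam i = [::])).
Proof.
split=> [lam rA rB lam_sorted rAB rBt szA szB _|t_odd lam lam_sorted].
  by apply: d3_eq0 => //; lia.
split=> [vanish|[r rt nil] z z0]; last exact: meval_twisted_schur_eq0 nil z0.
have [/existsP[r /eqP nil]|/existsPn nonempty] :=
  boolP [exists r : 'I_t, beta_class t lam r == [::]]; first by exists r.
(* One point z > 1 with a nonzero value refutes the identity; 2 serves. *)
have two_gt1 : (1 < 2%:R :> R[i])%R by rewrite ltr1n.
suff : (schur R[i] lam).@[twisted_point 2%:R%R] != 0%R.
  by rewrite vanish ?eqxx // pnatr_eq0.
apply: meval_twisted_schur_neq0 two_gt1 => // r rt.
exact/eqP/(nonempty (Ordinal rt)).
Qed.
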